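(* Let $A\subseteq\mathbb{F}_2^n$ be a subset of density $\alpha>0$. Then $A+A$ contains an affine subspace $V$ of $\mathbb{F}_2^n$ of dimension \[\dim(V)=\Omega\Big(\frac{\alpha}{\log^3(1/\alpha)}\,n\Big),\] where the implied constant is absolute.
   Context: The density of $A$ is $|A|/2^n$. $A+A=\{a+a': a,a'\in A\}$. Logarithms are to base 2.
   Formalization: The dimension bound is claimed only when A has at least two elements (it fails for a single point), and V being the whole space is accepted in place of the bound, which is undefined for density 1 and can exceed n for density near 1. *)

(* Defs.v *)
From HB Require Import structures.
From mathcomp Require Import all_boot all_order all_algebra.
From mathcomp Require Import all_classical all_reals all_analysis.

Set Implicit Arguments.
Unset Strict Implicit.
Unset Printing Implicit Defensive.

Import Order.TTheory GRing.Theory Num.Theory.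
Local Open Scope ring_scope.

Definition log2 (R : realType) (x : R) : R := ln x / ln 2.

Definition density (R : realType) (n : nat) (A : {set 'rV['F_2]_n}) : R :=
  #|A|%:R / 2 ^+ n.

Definition sumset (n : nat) (A B : {set 'rV['F_2]_n}) : {set 'rV['F_2]_n} :=
  [set a + b | a in A, b in B].

(* The affine subspaces of F_2^n are exactly the sets [affine_subspace x U]; the
   dimension of [affine_subspace x U] is [\dim U]. *)
Definition affine_subspace (n : nat) (x : 'rV['F_2]_n) (U : {vspace 'rV['F_2]_n}) :
  {set 'rV['F_2]_n} := [set x + u | u in U].

(* Main.v *)
Require Import Defs.
From HB Require Import structures.
From mathcomp Require Import all_boot all_order all_algebra.
From mathcomp Require Import all_classical all_reals all_analysis.
From mathcomp Require Import finfield ring lra.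

Set Implicit Arguments.
Unset Strict Implicit.
Unset Printing Implicit Defensive.

Import Order.TTheory GRing.Theory Num.Theory.
Local Open Scope ring_scope.

(* The method is Croot-Sisask almost periodicity.  Let f = 1_A * mu_A, whose
   support is A + A and whose mean is alpha.  Averaging 1_A over m random
   translates by elements of A, with m of order p log^2(1/alpha) / alpha,
   approximates f in L^p up to a factor 1/log(1/alpha) of |f|_p.  By pigeonhole
   there is a set T of density at least alpha^m / 2 such that T + T consists of
   L^p almost periods of f.  A density increment, costing O(m log(1/alpha))
   dimensions, replaces T by a subset of a coset of a subspace V on which every
   character nontrivial on V has bias at most 1/2.  Averaging f over
   l = O(log(1/alpha)) summands from T + T moves f little in L^p and, by Fourier
   expansion with nonnegative coefficients of sum 1, makes it V-invariant up to
   2 / 4^l pointwise.  Hence f is almost invariant in L^p under V, and for a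
   subspace U of V of dimension p an averaging over x produces a coset x + U on
   which f stays positive. *)

(** * Convexity and exponential inequalities *)

(** Convexity of the power by induction on [p]: multiplying the bound for [p] by y exceeds the
    tangent at the next exponent by (p+1) c^p (y - c)^2. *)
Lemma pow_tangent (R : realFieldType) (p : nat) (c y : R) :
  0 <= c -> 0 <= y -> c ^+ p.+1 + p.+1%:R * c ^+ p * (y - c) <= y ^+ p.+1.
Proof.
move=> c0 y0; elim: p => [|p IH]; first by rewrite expr0 !expr1; lra.
rewrite [y ^+ p.+2]exprS; apply: le_trans (ler_wpM2l y0 IH).
rewrite -subr_ge0.
have -> : y * (c ^+ p.+1 + p.+1%:R * c ^+ p * (y - c))
   - (c ^+ p.+2 + p.+2%:R * c ^+ p.+1 * (y - c))
   = p.+1%:R * c ^+ p * (y - c) ^+ 2.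
  by rewrite !exprS !mulrSr; ring.
by apply: mulr_ge0 (sqr_ge0 _); rewrite mulr_ge0 ?exprn_ge0 ?ler0n.
Qed.

(** Jensen's inequality: average the tangent bounds at the mean, where the linear terms cancel. *)
Lemma mean_pow_le (R : realFieldType) (I : finType) (J : {pred I}) (y : I -> R)
    (p : nat) :
  (forall i, i \in J -> 0 <= y i) -> (0 < #|J|)%N ->
  (#|J|%:R^-1 * \sum_(i in J) y i) ^+ p <=
    #|J|%:R^-1 * \sum_(i in J) y i ^+ p.
Proof.
move=> y0 J0; have J0' : (0 : R) < #|J|%:R by rewrite ltr0n.
case: p => [|p].
  rewrite expr0 (eq_bigr (fun=> 1)) => [|i _]; last by rewrite expr0.
  by rewrite sumr_const mulVf // gt_eqF.
set c := #|J|%:R^-1 * \sum_(i in J) y i.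
have c0 : 0 <= c by rewrite mulr_ge0 ?invr_ge0 ?ler0n ?sumr_ge0.
rewrite mulrC ler_pdivlMr //.
have -> : c ^+ p.+1 * #|J|%:R =
    \sum_(i in J) (c ^+ p.+1 + p.+1%:R * c ^+ p * (y i - c)).
  rewrite big_split /= -mulr_sumr sumrB !sumr_const.
  have -> : c *+ #|J| = \sum_(i in J) y i.
    by rewrite -mulr_natl /c mulrA divff ?mul1r ?gt_eqF.
  by rewrite subrr mulr0 addr0 mulr_natr.
by apply: ler_sum => i /y0 yi; exact: pow_tangent.
Qed.

Lemma sum_pow_le (R : realFieldType) (I : finType) (J : {pred I}) (y : I -> R)
    (p : nat) :
  (forall i, i \in J -> 0 <= y i) ->
  (\sum_(i in J) y i) ^+ p.+1 <= #|J|%:R ^+ p * \sum_(i in J) y i ^+ p.+1.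
Proof.
move=> y0; have [J0|] := posnP #|J|.
  by rewrite !big_pred0 ?expr0n ?mulr0 // => i; rewrite (card0_eq J0).
move=> J0; have J0' : (0 : R) < #|J|%:R by rewrite ltr0n.
have := mean_pow_le p.+1 y0 J0.
rewrite exprMn exprVn mulrC ler_pdivrMr ?exprn_gt0 // => /le_trans; apply.
by rewrite exprS mulrAC mulrA mulVf ?mul1r // gt_eqF.
Qed.

Lemma sum2_pow_le (R : realFieldType) (x y : R) (p : nat) :
  0 <= x -> 0 <= y -> (x + y) ^+ p.+1 <= 2 ^+ p * (x ^+ p.+1 + y ^+ p.+1).
Proof.
move=> x0 y0; have := @sum_pow_le R bool predT (fun b => if b then x else y) p.
by rewrite !big_bool card_bool /=; apply => -[].
Qed.

(** The p-th power of y/p <= e^(y/p). It trades moments for exponential moments. *)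
Lemma expR_ge_pow (R : realType) (p : nat) (y : R) :
  0 <= y -> y ^+ p <= p%:R ^+ p * expR y.
Proof.
move=> y0; case: p => [|p]; first by rewrite !expr0 mul1r -expR0 ler_expR.
have p0 : (0 : R) < p.+1%:R by rewrite ltr0n.
have -> : expR y = expR (y / p.+1%:R) ^+ p.+1.
  by rewrite -expRM_natl mulrC divfK ?gt_eqF.
rewrite -exprMn lerXn2r ?nnegrE ?mulr_ge0 ?expR_ge0 ?ler0n //.
rewrite -ler_pdivrMl // mulrC.
by apply: le_trans (expR_ge1Dx _); rewrite lerDr.
Qed.

(** From 1 - x <= e^(-x) and (1 + x + 2x^2)(1 - x) = 1 + x^2 (1 - 2x). *)
Lemma expR_le_quadratic (R : realType) (x : R) :
  x <= 2^-1 -> expR x <= 1 + x + 2 * x ^+ 2.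
Proof.
move=> x2; have h := expR_ge1Dx (- x).
have x1 : 0 < 1 - x by lra.
have {h} : expR x <= (1 - x)^-1.
  by rewrite -[expR x]invrK -expRN lef_pV2 ?posrE ?expR_gt0.
move=> /le_trans; apply; rewrite -div1r ler_pdivrMr //; nra.
Qed.

Lemma expR1_le4 (R : realType) : expR 1 <= 4 :> R.
Proof.
have -> : expR 1 = expR 2^-1 ^+ 2 :> R by rewrite -expRM_natl mulfV.
by have := @expR_le_quadratic R 2^-1 (lexx _); have := expR_ge0 (2^-1 : R); nra.
Qed.

(** * Moments of random samples *)

(** By independence the sum over A^m is an m-th power. The quadratic bound is applied to each 0/1
    variable, so the exponent keeps the factor [mu], which is the gain from small variance. *)
Lemma mgf_bound (R : realType) (T : finType) (A : {set T}) (b : T -> bool)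
    (m : nat) (mu lam : R) :
  lam <= 2^-1 -> mu * #|A|%:R = \sum_(a in A) (b a)%:R ->
  \sum_(a in ffun_on (mem A) : {pred {ffun 'I_m -> T}})
      expR (lam * (\sum_i (b (a i))%:R - m%:R * mu)) <=
    #|A|%:R ^+ m * expR (2 * m%:R * mu * lam ^+ 2).
Proof.
move=> lam2 muE.
have -> : \sum_(a in ffun_on (mem A) : {pred {ffun 'I_m -> T}})
      expR (lam * (\sum_i (b (a i))%:R - m%:R * mu)) =
    (\sum_(a in A) expR (lam * ((b a)%:R - mu))) ^+ m.
  transitivity (\prod_(i < m) (\sum_(a in A) expR (lam * ((b a)%:R - mu)))).
    rewrite (bigA_distr_big (mem A)); apply: eq_bigr => a _.
    rewrite -expR_sum -mulr_sumr sumrB sumr_const card_ord.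
    by rewrite mulr_natl.
  by rewrite prodr_const card_ord.
have -> : 2 * m%:R * mu * lam ^+ 2 = m%:R * (2 * mu * lam ^+ 2) by ring.
rewrite expRM_natl -exprMn lerXn2r ?nnegrE ?mulr_ge0 ?ler0n ?expR_ge0 //.
  by apply: sumr_ge0 => a _; exact: expR_ge0.
have step a : expR (lam * ((b a)%:R - mu)) <=
    (1 + (b a)%:R * (lam + 2 * lam ^+ 2)) * expR (- (lam * mu)).
  rewrite mulrBr expRD ler_wpM2r ?expR_ge0 //.
  case: (b a); rewrite ?mulr1 ?mul1r ?addrA ?expR_le_quadratic //.
  by rewrite mulr0 expR0 mul0r addr0.
apply: le_trans (ler_sum _ (fun a _ => step a)) _.
rewrite -mulr_suml big_split /= -mulr_suml sumr_const -muE.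
have -> : 2 * mu * lam ^+ 2 = mu * (lam + 2 * lam ^+ 2) - lam * mu by ring.
rewrite expRD (mulrA #|A|%:R) ler_wpM2r ?expR_ge0 //.
have -> : 1 *+ #|A| + mu * #|A|%:R * (lam + 2 * lam ^+ 2) =
  #|A|%:R * (1 + mu * (lam + 2 * lam ^+ 2)) by ring.
by rewrite ler_wpM2l ?ler0n ?expR_ge1Dx.
Qed.

(** The power is dominated by exponentials at [lam] and [- lam]; [lam] stays free so that it can be
    tuned to each point of the space. *)
Lemma moment_bound (R : realType) (T : finType) (A : {set T}) (b : T -> bool)
    (m p : nat) (mu lam : R) :
  0 < lam -> lam <= 2^-1 -> mu * #|A|%:R = \sum_(a in A) (b a)%:R ->
  \sum_(a in ffun_on (mem A) : {pred {ffun 'I_m -> T}})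
      `|\sum_i (b (a i))%:R - m%:R * mu| ^+ p <=
    2 * #|A|%:R ^+ m * ((p%:R / lam) ^+ p * expR (2 * m%:R * mu * lam ^+ 2)).
Proof.
move=> lam0 lam2 muE.
have pt (y : R) : `|y| ^+ p <= (p%:R / lam) ^+ p * (expR (lam * y) + expR (- lam * y)).
  have ly : 0 <= lam * `|y| by rewrite mulr_ge0 // ltW.
  have := expR_ge_pow p ly; rewrite exprMn -ler_pdivlMl ?exprn_gt0 //.
  move=> /le_trans; apply; rewrite exprMn exprVn mulrA [_^-1 * _]mulrC.
  rewrite ler_wpM2l ?mulr_ge0 ?invr_ge0 ?exprn_ge0 ?ler0n ?(ltW lam0) //.
  case: (ger0P y) => _; rewrite ?lerDl ?expR_ge0 //.
  by rewrite mulrN mulNr lerDr expR_ge0.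
apply: le_trans (ler_sum _ (fun a _ => pt _)) _.
rewrite -mulr_sumr big_split /=.
have h1 := mgf_bound m lam2 muE.
have h2 : - lam <= 2^-1 by lra.
have {}h2 := mgf_bound m h2 muE; rewrite sqrrN in h2.
set e := expR (2 * _ * _ * _) in h1 h2 *.
have P0 : 0 <= (p%:R / lam) ^+ p by rewrite exprn_ge0 ?mulr_ge0 ?invr_ge0 ?ler0n ?ltW.
have -> : 2 * #|A|%:R ^+ m * ((p%:R / lam) ^+ p * e) =
   (p%:R / lam) ^+ p * (#|A|%:R ^+ m * e + #|A|%:R ^+ m * e) by ring.
by rewrite ler_wpM2l // lerD.
Qed.

(** * The self-convolution and its almost periods *)

Lemma addrr_F2 (n : nat) (x : 'rV['F_2]_n) : x + x = 0.
Proof. by apply/rowP => i; rewrite !mxE addrr_pchar2 // pchar_Fp. Qed.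

Lemma addrK_F2 (n : nat) (x y : 'rV['F_2]_n) : x + y + y = x.
Proof. by rewrite -addrA addrr_F2 addr0. Qed.

Lemma card_rV_F2 (n : nat) : #|{: 'rV['F_2]_n}| = (2 ^ n)%N.
Proof. by rewrite card_mx card_Fp // mul1n. Qed.

(* [1_A * mu_A], the density of pairs of [A] with sum [x]; it is positive exactly on [A + A]. *)
Definition self_conv (R : realType) (n : nat) (A : {set 'rV['F_2]_n})
    (x : 'rV['F_2]_n) : R :=
  #|A|%:R^-1 * \sum_(a in A) (x + a \in A)%:R.

Definition sample_conv (R : realType) (n : nat) (A : {set 'rV['F_2]_n}) (m : nat)
    (a : {ffun 'I_m -> 'rV['F_2]_n}) (x : 'rV['F_2]_n) : R :=
  m%:R^-1 * \sum_i (x + a i \in A)%:R.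

Lemma self_conv_ge0 (R : realType) (n : nat) (A : {set 'rV['F_2]_n}) x :
  0 <= self_conv R A x.
Proof. by rewrite mulr_ge0 ?invr_ge0 ?ler0n ?sumr_ge0. Qed.

Lemma self_conv_gt0 (R : realType) (n : nat) (A : {set 'rV['F_2]_n}) x :
  0 < self_conv R A x -> x \in sumset A A.
Proof.
apply: contraTT => xA; rewrite -leNgt /self_conv big1 ?mulr0 // => a aA.
case: (boolP (x + a \in A)) => //= xaA; case/negP: xA; apply/imset2P.
by exists (x + a) a => //; rewrite addrK_F2.
Qed.

Lemma sum_self_conv (R : realType) (n : nat) (A : {set 'rV['F_2]_n}) :
  (0 < #|A|)%N -> \sum_x self_conv R A x = #|A|%:R.
Proof.
move=> A0; rewrite -mulr_sumr exchange_big /=.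
rewrite (eq_bigr (fun=> #|A|%:R)) => [|a _].
  by rewrite sumr_const -(mulr_natl #|A|%:R) mulKf // pnatr_eq0 -lt0n.
rewrite -natr_sum (reindex_inj (addIr a)) /=; congr _%:R.
under eq_bigr do rewrite addrK_F2.
by rewrite -sum1_card [RHS]big_mkcond; apply: eq_bigr => x _; case: ifP.
Qed.

(** Jensen, as the mean of [self_conv] is the density. This lets errors of order alpha^p at every
    point be absorbed into the L^p norm. *)
Lemma density_pow_le (R : realType) (n : nat) (A : {set 'rV['F_2]_n}) (p : nat) :
  (0 < #|A|)%N ->
  2 ^+ n * density R A ^+ p <= \sum_x self_conv R A x ^+ p.
Proof.
move=> A0.
have := @mean_pow_le R _ predT (self_conv R A) p (fun x _ => self_conv_ge0 R A x).
rewrite card_rV_F2 expn_gt0 => /(_ isT).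
rewrite sum_self_conv // natrX ler_pdivlMl ?exprn_gt0 //.
by rewrite /density [_^-1 * _]mulrC.
Qed.

Lemma density_gt0 (R : realType) (n : nat) (A : {set 'rV['F_2]_n}) :
  (0 < #|A|)%N -> 0 < density R A.
Proof. by move=> A0; rewrite divr_gt0 ?exprn_gt0 // ltr0n. Qed.

Lemma density_le1 (R : realType) (n : nat) (A : {set 'rV['F_2]_n}) :
  density R A <= 1.
Proof.
rewrite ler_pdivrMr ?exprn_gt0 // mul1r -natrX ler_nat.
by rewrite -card_rV_F2 max_card.
Qed.

(* Bounding the error by [d * max (f x) alpha], and not by [d] alone, is what
   lets [m] be of order [p / alpha] instead of [p / alpha ^ 2]. *)
Lemma sample_conv_error (R : realType) (n : nat) (A : {set 'rV['F_2]_n})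
    (m p : nat) (d : R) :
  (0 < #|A|)%N -> (0 < p)%N -> 0 < d -> d <= 2^-1 ->
  p%:R <= m%:R * density R A * d ^+ 2 ->
  m%:R * density R A * d ^+ 2 <= 2 * p%:R ->
  \sum_(a in ffun_on (mem A) : {pred {ffun 'I_m -> 'rV['F_2]_n}})
     \sum_x `|sample_conv R A a x - self_conv R A x| ^+ p <=
  #|A|%:R ^+ m * (4 * (256 * d) ^+ p * \sum_x self_conv R A x ^+ p).
Proof.
move=> A0 p0 d0 d2; have := density_pow_le R p A0; have := density_gt0 R A0.
move: (density R A) => al al0 alF lo hi.
have p0' : (0 : R) < p%:R by rewrite ltr0n.
have m0 : (0 : R) < m%:R.
  rewrite ltr0n lt0n; apply: contraTneq lo => ->.
  by rewrite !mul0r -ltNge.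
rewrite exchange_big /=.
pose f := self_conv R A; pose M x := Num.max (f x) al.
have step x : \sum_(a in ffun_on (mem A) : {pred {ffun 'I_m -> 'rV['F_2]_n}})
     `|sample_conv R A a x - f x| ^+ p <=
     2 * #|A|%:R ^+ m * ((256 * d) ^+ p * M x ^+ p).
  have alM : al <= M x by rewrite le_max lexx orbT.
  have fM : f x <= M x by rewrite le_max lexx.
  have f0 : 0 <= f x by exact: self_conv_ge0.
  have M0 : 0 < M x by exact: lt_le_trans alM.
  (* Balances the two factors of [moment_bound]: p / (lam m) is at most d M(x), while the exponent
     stays O(p). *)
  pose lam := d * al / M x.
  have lam0 : 0 < lam by rewrite /lam divr_gt0 // mulr_gt0.
  have lamd : lam <= d by rewrite /lam ler_pdivrMr // ler_wpM2l // ltW.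
  have muE : f x * #|A|%:R = \sum_(a in A) (x + a \in A)%:R.
    by rewrite mulrC mulVKf // pnatr_eq0 -lt0n.
  have := @moment_bound R _ A (fun a => x + a \in A) m p _ lam lam0
    (le_trans lamd d2) muE.
  have -> : \sum_(a in ffun_on (mem A) : {pred {ffun 'I_m -> 'rV['F_2]_n}})
      `|\sum_i (x + a i \in A)%:R - m%:R * f x| ^+ p =
    m%:R ^+ p * \sum_(a in ffun_on (mem A) : {pred {ffun 'I_m -> 'rV['F_2]_n}})
     `|sample_conv R A a x - f x| ^+ p.
    rewrite mulr_sumr; apply: eq_bigr => a _.
    rewrite -[m%:R in RHS]ger0_norm ?ler0n // -exprMn -normrM mulrBr.
    by rewrite mulVKf ?gt_eqF.
  rewrite -ler_pdivlMl ?exprn_gt0 // => /le_trans; apply.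
  rewrite mulrCA ler_wpM2l ?mulr_ge0 ?exprn_ge0 ?ler0n //.
  (* The exponent is 2 (m al d^2) (f(x) al / M(x)^2) <= 4p, and e <= 4 turns this into 4^4 = 256 per
     power. *)
  have e4 : expR (2 * m%:R * f x * lam ^+ 2) <= 256 ^+ p.
    apply: (@le_trans _ _ (expR (4 * p%:R))).
      rewrite ler_expR.
      have -> : 2 * m%:R * f x * lam ^+ 2 =
          2 * (m%:R * al * d ^+ 2) * (f x * al / M x ^+ 2).
        by rewrite /lam; field; rewrite gt_eqF.
      have fa : f x * al / M x ^+ 2 <= 1.
        by rewrite ler_pdivrMr ?exprn_gt0 // mul1r expr2 ler_pM // ltW.
      have fa0 : 0 <= f x * al / M x ^+ 2.
        by apply: divr_ge0; [rewrite mulr_ge0 // ltW | rewrite exprn_ge0 // ltW].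
      by nra.
    rewrite mulrC expRM_natl lerXn2r ?nnegrE ?expR_ge0 ?ler0n //.
    have -> : (256 : R) = 4 ^+ 4 by ring.
    have -> : (4 : R) = 4%:R * 1 by ring.
    by rewrite expRM_natl mulr1 lerXn2r ?nnegrE ?expR_ge0 ?ler0n ?expR1_le4.
  have pm0 : 0 <= m%:R^-1 * (p%:R / lam).
    by apply: mulr_ge0; [rewrite invr_ge0 ler0n | apply: divr_ge0 (ler0n _ _) (ltW lam0)].
  have pm : m%:R^-1 * (p%:R / lam) <= d * M x.
    have -> : m%:R^-1 * (p%:R / lam) = d * M x * (p%:R / (m%:R * al * d ^+ 2)).
      by rewrite /lam; field; rewrite !gt_eqF.
    apply: ler_piMr; first by apply: mulr_ge0; exact: ltW.
    by rewrite ler_pdivrMr ?mul1r // !mulr_gt0.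
  rewrite mulrA -exprVn -!exprMn [leRHS](_ : _ = (d * M x) ^+ p * 256 ^+ p).
    apply: ler_pM => //; rewrite ?exprn_ge0 ?expR_ge0 //.
    by rewrite lerXn2r ?nnegrE // (le_trans pm0).
  by rewrite -!exprMn; congr (_ ^+ _); ring.
apply: le_trans (ler_sum _ (fun x _ => step x)) _.
rewrite -mulr_sumr -mulr_sumr.
set F := \sum_x self_conv R A x ^+ p.
(* M^p <= f^p + al^p, and the sum of the constants al^p is at most F by [density_pow_le]. *)
have MF : \sum_x M x ^+ p <= 2 * F.
  have -> : 2 * F = F + F by ring.
  apply: le_trans (lerD (lexx F) alF).
  have -> : 2 ^+ n * al ^+ p = \sum_(x : 'rV['F_2]_n) al ^+ p.
    by rewrite sumr_const card_rV_F2 -natrX mulr_natl.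
  rewrite -big_split /=; apply: ler_sum => x _; rewrite /M maxEle.
  by case: ifP => _; rewrite ?lerDl ?lerDr exprn_ge0 ?self_conv_ge0 // ltW.
have K0 : 0 <= 2 * #|A|%:R ^+ m * (256 * d) ^+ p.
  by rewrite !mulr_ge0 ?exprn_ge0 ?mulr_ge0 ?ler0n // ltW.
by have := ler_wpM2l K0 MF; congr (_ <= _); ring.
Qed.

(* [t] is good for [a] when the translated sample [a + t] approximates [f]; the
   set [T] consists of the [t] that are good for one common [a], so that all
   [f (x + t)], [t] in [T], are close to the same function. *)
Lemma almost_periods (R : realType) (n : nat) (A : {set 'rV['F_2]_n})
    (m p : nat) (B : R) :
  (0 < #|A|)%N -> 0 < B ->
  \sum_(a in ffun_on (mem A) : {pred {ffun 'I_m -> 'rV['F_2]_n}})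
     \sum_x `|sample_conv R A a x - self_conv R A x| ^+ p.+1 <=
     #|A|%:R ^+ m * (B / 2) ->
  exists2 T : {set 'rV['F_2]_n},
    2 ^+ n * density R A ^+ m <= 2 * #|T|%:R &
    forall s t, s \in T -> t \in T ->
      \sum_x `|self_conv R A (x + s + t) - self_conv R A x| ^+ p.+1
        <= 2 ^+ p.+1 * B.
Proof.
move=> A0 B0; set f := self_conv R A.
pose Phi (a : {ffun 'I_m -> 'rV['F_2]_n}) :=
  \sum_x `|sample_conv R A a x - f x| ^+ p.+1.
rewrite -/(Phi _) => PhiB.
have Phi0 a : 0 <= Phi a by apply: sumr_ge0 => x _; rewrite exprn_ge0.
pose good : {set {ffun 'I_m -> 'rV['F_2]_n}} :=
  [set a in ffun_on (mem A) | Phi a <= B].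
(* Markov's inequality: at least half of the tuples in A^m have error at most B. *)
have goodP : (#|A| ^ m)%:R <= 2 * #|good|%:R :> R.
  have cA : (#|A| ^ m)%:R = \sum_(a in ffun_on (mem A) :
      {pred {ffun 'I_m -> 'rV['F_2]_n}}) (1 : R).
    by rewrite sumr_const card_ffun_on card_ord.
  have cg : #|good|%:R = \sum_(a in ffun_on (mem A) :
      {pred {ffun 'I_m -> 'rV['F_2]_n}}) (Phi a <= B)%R%:R :> R.
    rewrite -sum1_card natr_sum big_mkcond /= [RHS]big_mkcond /=.
    by apply: eq_bigr => a _; rewrite finset.inE; case: (_ \in _); case: (_ <= _).
  have h : (#|A| ^ m)%:R * B - #|good|%:R * B <= (#|A| ^ m)%:R * (B / 2).
    rewrite [in leRHS]natrX; apply: le_trans PhiB.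
    rewrite cA cg !mulr_suml -sumrB; apply: ler_sum => a _.
    rewrite -/(Phi a).
    by case: (leP (Phi a) B) => [_|/ltW]; rewrite /= ?mul1r ?mul0r ?subrr ?subr0.
  by rewrite -(ler_pM2r B0); nra.
pose shift (a : {ffun 'I_m -> 'rV['F_2]_n}) (t : 'rV['F_2]_n) : {ffun 'I_m -> 'rV['F_2]_n} :=
  [ffun i => a i + t].
pose T a : {set 'rV['F_2]_n} := [set t | shift a t \in good].
(* Double counting of pairs (a, t) with [shift a t] good: for each t the shift is an involution, so
   it contributes exactly |good| tuples. *)
have [a Ta] : exists a, 2 ^+ n * #|good|%:R <= (2 ^+ n) ^+ m * #|T a|%:R :> R.
  apply/existsP; apply: contraT; rewrite negb_exists => /forallP no.
  have : \sum_a (2 ^+ n) ^+ m * #|T a|%:R <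
      \sum_(a : {ffun 'I_m -> 'rV['F_2]_n}) 2 ^+ n * #|good|%:R :> R.
    apply: ltr_sum => [|a _]; last by rewrite ltNge no.
    by apply/hasP; exists [ffun=> 0]; rewrite ?mem_index_enum.
  rewrite sumr_const card_ffun card_rV_F2 card_ord -mulr_sumr -natr_sum.
  have -> : (\sum_a #|T a| = 2 ^ n * #|good|)%N.
    under eq_bigr => a _ do rewrite -sum1_card big_mkcond /=.
    rewrite exchange_big /= (eq_bigr (fun=> #|good|)) ?sum_nat_const ?card_rV_F2 //.
    move=> t _; rewrite (reindex_inj (h := shift^~ t)) /=; last first.
      by move=> a b /ffunP ab; apply/ffunP => i; have := ab i; rewrite !ffunE => /addIr.
    rewrite -sum1_card [RHS]big_mkcond; apply: eq_bigr => a _; rewrite inE.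
    suff -> : shift (shift a t) t = a by [].
    by apply/ffunP => i; rewrite !ffunE addrK_F2.
  by rewrite natrM natrX -(mulr_natl (2 ^+ n * #|good|%:R)) !natrX ltxx.
exists (T a).
  have N0 : (0 : R) < 2 ^+ n by rewrite exprn_gt0.
  have -> : density R A ^+ m = #|A|%:R ^+ m / (2 ^+ n) ^+ m by rewrite expr_div_n.
  rewrite mulrA ler_pdivrMr ?exprn_gt0 //.
  have := ler_wpM2l (ltW N0) goodP; rewrite natrX.
  have -> : 2 * #|T a|%:R * (2 ^+ n) ^+ m = 2 * ((2 ^+ n) ^+ m * #|T a|%:R) :> R by ring.
  by move=> /le_trans; apply; rewrite mulrCA ler_wpM2l.
have key t : t \in T a -> \sum_x `|sample_conv R A a x - f (x + t)| ^+ p.+1 <= B.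
  rewrite !inE => /andP[_]; congr (_ <= _); rewrite /Phi (reindex_inj (addIr t)) /=.
  apply: eq_bigr => x _; congr (`|_ - _| ^+ _).
  rewrite /sample_conv; congr (_ * _); apply: eq_bigr => i _.
  by rewrite ffunE [a i + t]addrC addrA addrK_F2.
(* After translating x by t, the comparison is between f(x + s) and f(x + t), both close to the
   sample of the common [a]. *)
move=> s t sT tT; rewrite (reindex_inj (addIr t)) /=.
have step x : `|f (x + t + s + t) - f (x + t)| ^+ p.+1 <=
   2 ^+ p * (`|sample_conv R A a x - f (x + s)| ^+ p.+1 +
             `|sample_conv R A a x - f (x + t)| ^+ p.+1).
  apply: le_trans (sum2_pow_le _ _ _) => //.
  rewrite addrAC addrK_F2 lerXn2r ?nnegrE ?addr_ge0 //.
  rewrite [X in _ <= X + _]distrC; apply: le_trans (ler_normD _ _).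
  by rewrite addrA subrK.
apply: le_trans (ler_sum _ (fun x _ => step x)) _.
rewrite -mulr_sumr big_split /= exprS -mulrA mulrCA ler_wpM2l ?exprn_ge0 //.
by have := key s sT; have := key t tT; lra.
Qed.

(** * Characters and Fourier expansion *)

(* The additive character [x |-> (-1) ^ <r, x>]. *)
Definition chi (R : realType) (n : nat) (r x : 'rV['F_2]_n) : R :=
  if x *m r^T == 0 then 1 else -1.

Lemma mx11_F2_add (u v : 'M['F_2]_1) : u != 0 -> v != 0 -> u + v = 0.
Proof.
have F2 (a : 'F_2) : a != 0 -> a = 1.
  by move=> a0; apply/val_inj; case: a a0 => [[|[|]]].
have M1 (w : 'M['F_2]_1) : w != 0 -> w = 1%:M.
  move=> w0; rewrite [w]mx11_scalar; congr _%:M; apply: F2.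
  by apply: contraNneq w0 => w00; rewrite [w]mx11_scalar w00 raddf0.
by move=> /M1 -> /M1 ->; exact: addrr_F2.
Qed.

Lemma chiC (R : realType) (n : nat) (r x : 'rV['F_2]_n) : chi R r x = chi R x r.
Proof. by rewrite /chi -[x *m r^T]trmxK trmx_mul trmxK trmx_eq0. Qed.

Lemma chiD (R : realType) (n : nat) (r x y : 'rV['F_2]_n) :
  chi R r (x + y) = chi R r x * chi R r y.
Proof.
rewrite /chi mulmxDl.
have [->|x0] := eqVneq (x *m r^T) 0; first by rewrite add0r mul1r.
have [->|y0] := eqVneq (y *m r^T) 0; first by rewrite addr0 (negPf x0) mulr1.
by rewrite mx11_F2_add // eqxx mulrNN mulr1.
Qed.

Lemma chiDl (R : realType) (n : nat) (r s x : 'rV['F_2]_n) :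
  chi R (r + s) x = chi R r x * chi R s x.
Proof. by rewrite !(chiC R _ x) chiD. Qed.

Lemma chi_norm (R : realType) (n : nat) (r x : 'rV['F_2]_n) : `|chi R r x| = 1.
Proof. by rewrite /chi; case: ifP; rewrite ?normrN normr1. Qed.

Lemma chi0 (R : realType) (n : nat) (r : 'rV['F_2]_n) : chi R r 0 = 1.
Proof. by rewrite /chi mul0mx eqxx. Qed.

Lemma chi_eq1 (R : realType) (n : nat) (r x : 'rV['F_2]_n) :
  (chi R r x == 1) = (x *m r^T == 0).
Proof.
rewrite /chi; case: ifP; rewrite ?eqxx // => _.
by apply/negbTE; rewrite lt_eqF // (lt_trans _ ltr01) // oppr_lt0.
Qed.

(** If x has a nonzero i-th coordinate, adding the i-th unit vector to r negates the character, so
    the sum equals its own negative. *)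
Lemma sum_chi (R : realType) (n : nat) (x : 'rV['F_2]_n) :
  \sum_r chi R r x = 2 ^+ n * (x == 0)%:R.
Proof.
have [->|x0] := eqVneq x 0.
  under eq_bigr do rewrite chi0.
  by rewrite sumr_const card_rV_F2 mulr1 natrX.
have [i xi] : exists i, x 0 i != 0.
  apply/existsP; apply: contraNT x0; rewrite negb_exists => /forallP h.
  by apply/eqP/rowP => i; have := h i; rewrite negbK mxE => /eqP.
have cN : chi R (delta_mx 0 i) x = -1.
  rewrite /chi trmx_delta -colE ifF //; apply: contraNF xi => /eqP/colP/(_ 0).
  by rewrite !mxE => ->.
set S := \sum_r _; suff : S = - S by move=> ?; rewrite mulr0; lra.
rewrite {1}/S (reindex_inj (addIr (delta_mx 0 i))) /= -mulN1r mulr_sumr.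
by apply: eq_bigr => r _; rewrite chiDl cN mulrC.
Qed.

(** The Fourier coefficient of [self_conv]: the squared coefficient of 1_A divided by the density of
    A. *)
Definition self_conv_coef (R : realType) (n : nat) (A : {set 'rV['F_2]_n})
    (r : 'rV['F_2]_n) : R :=
  (2 ^+ n * #|A|%:R)^-1 * (\sum_(a in A) chi R r a) ^+ 2.

Lemma self_conv_coef_ge0 (R : realType) (n : nat) (A : {set 'rV['F_2]_n}) r :
  0 <= self_conv_coef R A r.
Proof. by rewrite mulr_ge0 ?sqr_ge0 // invr_ge0 mulr_ge0 ?ler0n. Qed.

(** Expand the square; orthogonality keeps only the pairs with b = x + a. *)
Lemma self_conv_fourier (R : realType) (n : nat) (A : {set 'rV['F_2]_n}) x :
  self_conv R A x = \sum_r self_conv_coef R A r * chi R r x.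
Proof.
have -> : \sum_r self_conv_coef R A r * chi R r x =
  (2 ^+ n * #|A|%:R)^-1 * \sum_(a in A) \sum_(b in A) \sum_r chi R r (a + b + x).
  under [in RHS]eq_bigr => a _ do rewrite exchange_big /=.
  rewrite [in RHS]exchange_big mulr_sumr /=; apply: eq_bigr => r _.
  rewrite /self_conv_coef -mulrA; congr (_ * _); rewrite expr2 !mulr_suml.
  apply: eq_bigr => a _; rewrite mulr_sumr mulr_suml.
  by apply: eq_bigr => b _; rewrite !chiD.
rewrite /self_conv invfM mulrC; have N0 : (2 : R) ^+ n != 0 by rewrite expf_neq0.
rewrite [_^-1 * _]mulrC -mulrA mulrC; congr (_ * _); rewrite mulr_sumr.
apply: eq_bigr => a aA; under eq_bigr do rewrite sum_chi.
rewrite -mulr_sumr mulKf // -natr_sum; congr _%:R.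
have e b : (a + b + x == 0) = (b == x + a).
  apply/eqP/eqP => [h|->]; last by rewrite addrAC [a + x]addrC addrr_F2.
  by apply: (addIr (x + a)); rewrite addrr_F2 -[RHS]h [x + a]addrC addrA [b + a]addrC.
under eq_bigr do rewrite e.
have [xaA|xaA] := boolP (x + a \in A).
  rewrite (bigD1 (x + a)) //= eqxx big1 ?addn0 // => b /andP[_ /negPf ->].
  by [].
by rewrite big1 // => b bA; rewrite (negPf (memPn xaA _ bA)).
Qed.

(** * Density increment and subspace dimensions *)

(* Density increment: as long as some character that is nontrivial on [V] is
   biased on [T], one of its two level sets contains 3/4 of [T] and lies in a
   coset of a proper subspace of [V]. *)
Lemma regular_subset (R : realType) (n : nat) (T : {set 'rV['F_2]_n})
    (V : {vspace 'rV['F_2]_n}) :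
  (0 < #|T|)%N -> (forall s t, s \in T -> t \in T -> s + t \in V) ->
  exists (T' : {set 'rV['F_2]_n}) (V' : {vspace 'rV['F_2]_n}),
    [/\ T' \subset T, (0 < #|T'|)%N, (\dim V' <= \dim V)%N,
      forall s t, s \in T' -> t \in T' -> s + t \in V' &
      (3 / 4) ^+ (\dim V - \dim V') * #|T|%:R <= #|T'|%:R :> R /\
      forall r v, v \in V' -> chi R r v != 1 ->
        `|\sum_(t in T') chi R r t| <= #|T'|%:R / 2].
Proof.
have [k Vk] := ubnP (\dim V); elim: k => // k IH in T V Vk * => T0 TV.
have [[r [v [vV rv]]]|no] := pselect (exists r v, [/\ v \in V, chi R r v != 1 &
    #|T|%:R / 2 < `|\sum_(t in T) chi R r t|]); last first.
  exists T, V; split => //; split; first by rewrite subnn expr0 mul1r.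
  by move=> r v vV rv; rewrite leNgt; apply/negP => h; apply: no; exists r, v.
move=> big.
pose S b := [set t in T | (t *m r^T == 0) == b].
have cardS : #|S true|%:R + #|S false|%:R = #|T|%:R :> R.
  rewrite -natrD -(cardsID [set t | t *m r^T == 0] T); congr (_ + _)%:R.
    by apply: eq_card => t; rewrite !inE; case: (_ == 0).
  by apply: eq_card => t; rewrite !inE eqbF_neg andbC.
have sumS : \sum_(t in T) chi R r t = #|S true|%:R - #|S false|%:R.
  rewrite (bigID (fun t => t *m r^T == 0)) /=; congr (_ + _).
    rewrite (eq_bigr (fun=> 1)) => [|t /andP[_ t0]]; last by rewrite /chi t0.
    by rewrite sumr_const; congr (_ *+ _); apply: eq_card => t; rewrite !inE eqb_id.
  rewrite (eq_bigr (fun=> -1)) => [|t /andP[_ /negPf t0]]; last by rewrite /chi t0.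
  rewrite sumr_const mulNrn; congr (- (_ *+ _)).
  by apply: eq_card => t; rewrite !inE eqbF_neg.
have [b Sb] : exists b, 3 / 4 * #|T|%:R <= #|S b|%:R :> R.
  move: big; rewrite sumS; case: ger0P => _ h; [exists true | exists false]; lra.
pose W := (V :&: lker (linfun (mulmxr r^T)))%VS.
have inW x : (x \in W) = (x \in V) && (x *m r^T == 0).
  by rewrite memv_cap memv_ker lfunE.
have WV : (\dim W < \dim V)%N.
  rewrite ltnNge; apply/negP => VW.
  have /eqP WE : W == V by rewrite eqEdim capvSl.
  by move: vV rv; rewrite chi_eq1 -WE inW => /andP[_ ->].
have Sb0 : (0 < #|S b|)%N.
  by rewrite -(ltr0n R); apply: lt_le_trans Sb; rewrite mulr_gt0 ?divr_gt0 // ltr0n.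
have SW s t : s \in S b -> t \in S b -> s + t \in W.
  rewrite !inE inW => /andP[sT sb] /andP[tT tb]; rewrite TV //= -(chi_eq1 R) chiD.
  by rewrite /chi (eqP sb) (eqP tb); case: (b); rewrite ?mulr1 ?mulrNN ?mulr1.
have [T' [V' [T'S T'0 V'W T'V' [h1 h2]]]] := IH _ _ (leq_trans WV Vk) Sb0 SW.
exists T', V'; split => //.
- by apply: (fintype.subset_trans T'S); apply/fintype.subsetP => t; rewrite finset.inE => /andP[].
- exact: leq_trans V'W (ltnW WV).
split => //; apply: le_trans h1.
have q0 : 0 <= 3 / 4 :> R by [].
(* Passing to [W] costs one factor 3/4 and lowers the dimension by at least one. *)
apply: (@le_trans _ _ ((3 / 4) ^+ (\dim W - \dim V').+1 * #|T|%:R)).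
  rewrite ler_wpM2r ?ler0n // ler_wiXn2l //; first by lra.
  by rewrite -subSn // leq_sub2r.
by rewrite exprSr -mulrA ler_wpM2l ?exprn_ge0.
Qed.

Lemma card_coset_le (n : nat) (T : {set 'rV['F_2]_n}) (V : {vspace 'rV['F_2]_n}) :
  (forall s t, s \in T -> t \in T -> s + t \in V) -> (#|T| <= 2 ^ \dim V)%N.
Proof.
move=> TV; have [->|[t0 t0T]] := set_0Vmem T; first by rewrite cards0.
have <- : #|V| = (2 ^ \dim V)%N by rewrite card_vspace card_Fp.
rewrite -(card_imset _ (addIr t0)).
by apply: subset_leq_card; apply/fintype.subsetP => _ /imsetP[t tT ->]; exact: TV.
Qed.

Lemma subspace_of_dim (K : fieldType) (W : vectType K) (V : {vspace W}) (k : nat) :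
  (k <= \dim V)%N -> exists2 U : {vspace W}, (U <= V)%VS & \dim U = k.
Proof.
move=> kV; exists <<take k (vbasis V)>>%VS.
  by apply/span_subvP => v /mem_take; exact: vbasis_mem.
have : free (take k (vbasis V)).
  by have := basis_free (vbasisP V); rewrite -{1}(cat_take_drop k (vbasis V)) => /catl_free.
by move=> /eqP ->; rewrite size_takel // size_tuple.
Qed.

(** * Smoothing by almost periods *)

Lemma mean_Lp_le (R : realFieldType) (X I : finType) (J : {pred I})
    (F : I -> X -> R) (p : nat) (B : R) :
  (0 < #|J|)%N -> (forall u, u \in J -> \sum_x `|F u x| ^+ p <= B) ->
  \sum_x `|#|J|%:R^-1 * \sum_(u in J) F u x| ^+ p <= B.
Proof.
move=> J0 FB; have J0' : (0 : R) < #|J|%:R by rewrite ltr0n.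
have step x : `|#|J|%:R^-1 * \sum_(u in J) F u x| ^+ p <=
    #|J|%:R^-1 * \sum_(u in J) `|F u x| ^+ p.
  apply: le_trans (mean_pow_le p (fun u _ => normr_ge0 (F u x)) J0).
  have k0 : 0 <= #|J|%:R^-1 :> R by rewrite invr_ge0 ler0n.
  rewrite lerXn2r ?nnegrE ?mulr_ge0 ?sumr_ge0 //.
  by rewrite normrM ger0_norm // ler_wpM2l // ler_norm_sum.
apply: le_trans (ler_sum _ (fun x _ => step x)) _.
rewrite -mulr_sumr exchange_big /= ler_pdivrMl //.
apply: le_trans (ler_sum _ FB) _.
by rewrite sumr_const mulr_natl.
Qed.

(** Convolution with mu_T * mu_T: every shift is a sum of two elements of T, hence an almost period,
    and the Fourier multipliers are squares. *)
Definition smooth (R : realType) (n : nat) (T : {set 'rV['F_2]_n})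
    (h : 'rV['F_2]_n -> R) (x : 'rV['F_2]_n) : R :=
  #|finset.setX T T|%:R^-1 * \sum_(u in finset.setX T T) h (x + u.1 + u.2).

Lemma smooth_contraction (R : realType) (n : nat) (T : {set 'rV['F_2]_n})
    (h k : 'rV['F_2]_n -> R) (p : nat) :
  (0 < #|T|)%N ->
  \sum_x `|smooth T h x - smooth T k x| ^+ p <= \sum_x `|h x - k x| ^+ p.
Proof.
move=> T0; have TT0 : (0 < #|finset.setX T T|)%N by rewrite cardsX muln_gt0 T0.
under eq_bigr do rewrite /smooth -mulrBr -sumrB.
apply: (mean_Lp_le (F := fun u x => h (x + u.1 + u.2) - k (x + u.1 + u.2))) => // u _.
by rewrite [leRHS](reindex_inj (addIr (u.1 + u.2))) /=; under eq_bigr do rewrite -addrA.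
Qed.

Lemma smooth_close (R : realType) (n : nat) (T : {set 'rV['F_2]_n})
    (h : 'rV['F_2]_n -> R) (p : nat) (B : R) :
  (0 < #|T|)%N ->
  (forall s t, s \in T -> t \in T -> \sum_x `|h (x + s + t) - h x| ^+ p <= B) ->
  \sum_x `|smooth T h x - h x| ^+ p <= B.
Proof.
move=> T0 hB; have TT0 : (0 < #|finset.setX T T|)%N by rewrite cardsX muln_gt0 T0.
have e x : smooth T h x - h x =
    #|finset.setX T T|%:R^-1 * \sum_(u in finset.setX T T) (h (x + u.1 + u.2) - h x).
  rewrite sumrB sumr_const mulrBr; congr (_ - _).
  by rewrite -(mulr_natl (h x)) mulKf // pnatr_eq0 -lt0n.
under eq_bigr do rewrite e.
apply: (mean_Lp_le (F := fun u x => h (x + u.1 + u.2) - h x)) => // u.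
by rewrite finset.inE => /andP[]; exact: hB.
Qed.

(** Telescoping: by contraction each further step moves the function no more than the first, so the
    L^p distance grows by a factor at most [l]. *)
Lemma iter_smooth_close (R : realType) (n : nat) (T : {set 'rV['F_2]_n})
    (h : 'rV['F_2]_n -> R) (l p : nat) (B : R) :
  (0 < #|T|)%N -> \sum_x `|smooth T h x - h x| ^+ p.+1 <= B ->
  \sum_x `|iter l (smooth T) h x - h x| ^+ p.+1 <= l%:R ^+ p.+1 * B.
Proof.
move=> T0 hB; pose g i := iter i (smooth T) h.
have gB i : \sum_x `|g i.+1 x - g i x| ^+ p.+1 <= B.
  by elim: i => [|i IH] //; apply: le_trans (smooth_contraction _ _ _ T0) IH.
have step x : `|g l x - h x| ^+ p.+1 <=
    l%:R ^+ p * \sum_(i < l) `|g i.+1 x - g i x| ^+ p.+1.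
  have := @sum_pow_le R _ predT (fun i : 'I_l => `|g i.+1 x - g i x|) p.
  rewrite card_ord => /(_ (fun _ _ => normr_ge0 _)); apply: le_trans.
  rewrite lerXn2r ?nnegrE ?sumr_ge0 //.
  have -> : g l x - h x = \sum_(i < l) (g i.+1 x - g i x).
    by rewrite -(big_mkord xpredT (fun i => g i.+1 x - g i x)) telescope_sumr.
  exact: ler_norm_sum.
apply: le_trans (ler_sum _ (fun x _ => step x)) _.
rewrite -mulr_sumr exchange_big /= exprSr -mulrA ler_wpM2l ?exprn_ge0 ?ler0n //.
apply: le_trans (ler_sum _ (fun (i : 'I_l) _ => gB i)) _.
by rewrite sumr_const card_ord mulr_natl.
Qed.

(** Characters are eigenfunctions of [smooth], with eigenvalue the squared mean of the character
    over T. *)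
Lemma iter_smooth_fourier (R : realType) (n : nat) (T : {set 'rV['F_2]_n})
    (c : 'rV['F_2]_n -> R) (l : nat) :
  iter l (smooth T) (fun x => \sum_r c r * chi R r x) =
  fun x => \sum_r c r * ((#|T|%:R^-1 * \sum_(t in T) chi R r t) ^+ 2) ^+ l * chi R r x.
Proof.
elim: l => [|l /= ->]; first by apply/funext => x; under [RHS]eq_bigr do rewrite expr0 mulr1.
apply/funext => x; rewrite /smooth exchange_big /= mulr_sumr.
apply: eq_bigr => r _; rewrite -mulr_sumr (exprSr _ l) cardsX natrM.
set m := #|T|%:R^-1 * _; set e := (m ^+ 2) ^+ l.
have -> : \sum_(u in finset.setX T T) chi R r (x + u.1 + u.2) =
    (\sum_(t in T) chi R r t) ^+ 2 * chi R r x.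
  transitivity (\sum_(s in T) \sum_(t in T) chi R r (x + s + t)).
    by rewrite pair_big /=; apply: eq_bigl => u; rewrite finset.inE.
  rewrite expr2 !mulr_suml; apply: eq_bigr => s _.
  by rewrite mulr_sumr mulr_suml; apply: eq_bigr => t _; rewrite !chiD; ring.
rewrite invfM /m; ring.
Qed.

(** Characters trivial at v cancel; each other one has multiplier at most 4^(-l) and changes by at
    most 2. The nonnegative coefficients sum to [self_conv] at 0, which is 1. *)
Lemma iter_smooth_translate (R : realType) (n : nat) (A T : {set 'rV['F_2]_n})
    (V : {vspace 'rV['F_2]_n}) (l : nat) (x v : 'rV['F_2]_n) :
  (0 < #|A|)%N -> (0 < #|T|)%N ->
  (forall r w, w \in V -> chi R r w != 1 ->
     `|\sum_(t in T) chi R r t| <= #|T|%:R / 2) ->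
  v \in V ->
  `|iter l (smooth T) (self_conv R A) (x + v) - iter l (smooth T) (self_conv R A) x|
    <= 2 / 4 ^+ l.
Proof.
move=> A0 T0 TV vV.
have -> : self_conv R A = fun x => \sum_r self_conv_coef R A r * chi R r x.
  by apply/funext => y; exact: self_conv_fourier.
rewrite iter_smooth_fourier -sumrB; apply: le_trans (ler_norm_sum _ _ _) _.
have sum_coef : \sum_r self_conv_coef R A r = 1.
  transitivity (self_conv R A 0).
    by rewrite self_conv_fourier; apply: eq_bigr => r _; rewrite chi0 mulr1.
  rewrite /self_conv (eq_bigr (fun=> 1)) => [|a aA]; last by rewrite add0r aA.
  by rewrite sumr_const mulVf // pnatr_eq0 -lt0n.
have -> : 2 / 4 ^+ l = \sum_r self_conv_coef R A r * (2 / 4 ^+ l).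
  by rewrite -mulr_suml sum_coef mul1r.
apply: ler_sum => r _.
set m := #|T|%:R^-1 * _; have c0 := self_conv_coef_ge0 R A r.
have -> : self_conv_coef R A r * (m ^+ 2) ^+ l * chi R r (x + v) -
    self_conv_coef R A r * (m ^+ 2) ^+ l * chi R r x =
    self_conv_coef R A r * ((m ^+ 2) ^+ l * (chi R r x * (chi R r v - 1))).
  by rewrite chiD; ring.
rewrite (normrM (self_conv_coef R A r)) (ger0_norm c0) ler_wpM2l //.
rewrite (normrM ((m ^+ 2) ^+ l)) (normrM (chi R r x)) chi_norm mul1r.
have [->|rv] := eqVneq (chi R r v) 1; first by rewrite subrr normr0 mulr0 divr_ge0 ?exprn_ge0.
have c2 : `|chi R r v - 1| <= 2.
  by apply: le_trans (ler_normB _ _) _; rewrite chi_norm normr1; lra.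
have m2 : `|(m ^+ 2) ^+ l| <= (4 ^+ l)^-1.
  rewrite normrX -exprVn lerXn2r ?nnegrE // normrX.
  have -> : 4^-1 = (2^-1) ^+ 2 :> R by field.
  rewrite lerXn2r ?nnegrE // /m normrM ger0_norm ?invr_ge0 ?ler0n //.
  by rewrite ler_pdivrMl ?ltr0n //; exact: TV vV rv.
by rewrite mulrC ler_pM.
Qed.

(** * From almost invariance to a coset in the sumset *)

(** Go from h(x) to g(x) to g(x + v) to h(x + v); the three errors account for the constant 3. *)
Lemma translate_close (R : realType) (n : nat) (h g : 'rV['F_2]_n -> R)
    (v : 'rV['F_2]_n) (p : nat) (B e : R) :
  \sum_x `|g x - h x| ^+ p.+1 <= B -> (forall x, `|g (x + v) - g x| <= e) ->
  2 ^+ n * e ^+ p.+1 <= B ->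
  \sum_x `|h (x + v) - h x| ^+ p.+1 <= 3 ^+ p.+1 * B.
Proof.
move=> ghB ge eB.
have step x : `|h (x + v) - h x| ^+ p.+1 <= 3 ^+ p *
   (`|g (x + v) - h (x + v)| ^+ p.+1 + `|g x - h x| ^+ p.+1 + e ^+ p.+1).
  pose y (i : 'I_3) := nth 0 [:: `|g (x + v) - h (x + v)|; `|g x - h x|; e] i.
  have e0 : 0 <= e by apply: le_trans (ge x).
  have y0 i : i \in predT -> 0 <= y i by case: i => [[|[|[|i]]] i3] _; rewrite /y /=.
  have := sum_pow_le p y0; rewrite card_ord !big_ord_recr !big_ord0 /= !add0r /y /=.
  apply: le_trans; rewrite lerXn2r ?nnegrE ?addr_ge0 //.
  have -> : h (x + v) - h x =
    - (g (x + v) - h (x + v)) + (g x - h x) + (g (x + v) - g x) by ring.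
  apply: le_trans (ler_normD _ _) _; apply: lerD => //.
  by rewrite -[X in _ <= X + _]normrN ler_normD.
apply: le_trans (ler_sum _ (fun x _ => step x)) _.
rewrite -mulr_sumr !big_split /= (exprSr 3) -mulrA ler_wpM2l ?exprn_ge0 //.
have := ghB; rewrite (reindex_inj (addIr v)) /=.
by rewrite sumr_const card_rV_F2 -(mulr_natl (e ^+ p.+1)) natrX; lra.
Qed.

(** Summed over U and x, the errors stay below the sum of f^(p+1), so at some x the errors over U
    total less than f(x)^(p+1). There every |f(x + v) - f(x)| is below f(x), so f(x + v) > 0. *)
Lemma affine_subspace_sumset (R : realType) (n : nat) (A : {set 'rV['F_2]_n})
    (U : {vspace 'rV['F_2]_n}) (p : nat) (th : R) :
  (0 < #|A|)%N -> 2 ^+ \dim U * th < 1 ->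
  (forall v, v \in U -> \sum_x `|self_conv R A (x + v) - self_conv R A x| ^+ p.+1
     <= th * \sum_x self_conv R A x ^+ p.+1) ->
  exists x, affine_subspace x U \subset sumset A A.
Proof.
move=> A0 th1 Uth; set f := self_conv R A in Uth *; set F := \sum_x f x ^+ p.+1 in Uth *.
have F0 : 0 < F.
  apply: lt_le_trans (density_pow_le R p.+1 A0).
  by rewrite mulr_gt0 ?exprn_gt0 ?density_gt0.
pose D x := \sum_(v in U) `|f (x + v) - f x| ^+ p.+1.
have [x Dx] : exists x, D x < f x ^+ p.+1.
  apply/existsP; apply: contraT; rewrite negb_exists => /forallP no.
  have : F <= \sum_x D x by apply: ler_sum => x _; rewrite leNgt no.
  rewrite leNgt exchange_big /=; apply: contraNT => _.
  apply: le_lt_trans (ler_sum _ Uth) _.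
  by rewrite sumr_const card_vspace card_Fp // -mulr_natl natrX mulrA -[ltRHS]mul1r ltr_pM2r.
exists x; apply/fintype.subsetP => _ /imsetP[v vU ->]; apply: (@self_conv_gt0 R).
have fx0 : 0 <= f x by exact: self_conv_ge0.
have : `|f (x + v) - f x| < f x.
  rewrite ltNge; apply: contraL Dx => h; rewrite -leNgt.
  apply: (le_trans (lerXn2r p.+1 fx0 (normr_ge0 _) h)).
  by rewrite /D (bigD1 v) //= lerDl sumr_ge0 // => w _; rewrite exprn_ge0.
by rewrite ltr_norml => /andP[h _]; rewrite -/f; lra.
Qed.

(** * Choice of parameters *)

(** Because (3/2)^2 > 2. *)
Lemma exponent_le (R : realFieldType) (c k : nat) :
  (3 / 2 : R) ^+ c <= 2 ^+ k -> (c <= 2 * k)%N.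
Proof.
apply: contraTT; rewrite -ltnNge -ltNge => kc.
have q1 : 1 <= 3 / 2 :> R by lra.
apply: lt_le_trans (ler_weXn2l q1 kc); rewrite exprS exprM.
apply: (@le_lt_trans _ _ (((3 / 2) ^+ 2) ^+ k)).
  by rewrite lerXn2r ?nnegrE ?exprn_ge0 //; lra.
by rewrite ltr_pMl; [lra | rewrite !exprn_gt0].
Qed.

(** With c the codimension of V, T' has at least (3/4)^c |T| elements and, lying in a coset of V, at
    most 2^(n-c). Hence (3/2)^c al^m <= 2, and al >= 2^(-j) bounds c. *)
Lemma regular_subset_dim (R : realType) (n : nat) (T : {set 'rV['F_2]_n})
    (al : R) (j m : nat) :
  0 < al -> 1 <= al * 2 ^+ j -> 2 ^+ n * al ^+ m <= 2 * #|T|%:R ->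
  exists (T' : {set 'rV['F_2]_n}) (V : {vspace 'rV['F_2]_n}),
    [/\ T' \subset T, (0 < #|T'|)%N, (n <= \dim V + 2 * (1 + j * m))%N &
      forall r v, v \in V -> chi R r v != 1 ->
        `|\sum_(t in T') chi R r t| <= #|T'|%:R / 2].
Proof.
move=> al0 alj TN.
have T0 : (0 < #|T|)%N.
  rewrite -(ltr0n R) -(@pmulr_rgt0 _ 2) //.
  by apply: lt_le_trans TN; rewrite mulr_gt0 ?exprn_gt0.
have dn : \dim {:'rV['F_2]_n} = n by rewrite dimvf /dim /= mul1n.
have [T' [V [T'T T'0 Vn T'V [h reg]]]] :=
  @regular_subset R n T fullv T0 (fun s t _ _ => memvf (s + t)).
exists T', V; split => //; rewrite dn in Vn h.
rewrite -leq_subLR; apply: (@exponent_le R).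
have h2 : #|T'|%:R <= 2 ^+ \dim V :> R by rewrite -natrX ler_nat; exact: card_coset_le.
set c := (n - \dim V)%N in h *.
have nc : (2 : R) ^+ n = 2 ^+ c * 2 ^+ \dim V by rewrite -exprD subnK.
have W0 : 0 < (2 : R) ^+ \dim V by rewrite exprn_gt0.
have q0 : 0 <= (3 / 4 : R) ^+ c by rewrite exprn_ge0.
have e1 : (3 / 2) ^+ c * al ^+ m <= 2.
  rewrite -(ler_pM2r W0).
  have -> : (3 / 2 : R) ^+ c = (3 / 4) ^+ c * 2 ^+ c by rewrite -exprMn; congr (_ ^+ _); field.
  have := ler_wpM2l q0 TN; rewrite nc => h3.
  have := le_trans h h2; set Tc := #|T|%:R; rewrite -/Tc in h3 *; move=> h4.
  by move: h3 h4; set q := (3 / 4) ^+ c; set a := al ^+ m; nra.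
rewrite exprS exprM.
apply: (@le_trans _ _ ((3 / 2) ^+ c * al ^+ m * (2 ^+ j) ^+ m)); last first.
  by rewrite ler_wpM2r ?exprn_ge0.
by rewrite -mulrA -exprMn ler_peMr ?exprn_ge0 // exprn_ege1.
Qed.

(** Rounding y / al up overshoots y by at most al <= 1 <= y. *)
Lemma sample_size (R : realType) (y al : R) :
  0 < al -> al <= 1 -> 1 <= y ->
  exists m : nat, y <= m%:R * al /\ m%:R * al <= 2 * y.
Proof.
move=> al0 al1 y1; exists (Num.truncn (y / al)).+1.
have ya : 0 <= y / al by rewrite divr_ge0 ?ltW // (lt_le_trans ltr01).
have ya' : y / al * al = y by rewrite divfK ?gt_eqF.
have /andP[lo hi] := truncn_itv ya; split.
  by rewrite -[leLHS]ya' ler_wpM2r // ltW.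
by rewrite -addn1 natrD mulrDl mul1r; have := ler_wpM2r (ltW al0) lo; rewrite ya'; lra.
Qed.

Lemma sumset_affine_subspace (R : realType) (n : nat) (A : {set 'rV['F_2]_n})
    (j p : nat) :
  (0 < #|A|)%N -> (0 < j)%N -> 1 <= density R A * 2 ^+ j ->
  2 ^+ 40 * p.+1%:R * j%:R ^+ 3 <= density R A * n%:R ->
  exists (x : 'rV['F_2]_n) (U : {vspace 'rV['F_2]_n}),
    affine_subspace x U \subset sumset A A /\ \dim U = p.+1.
Proof.
move=> A0 j0 alj large; set al := density R A in alj large.
have al0 : 0 < al by exact: density_gt0.
have al1 : al <= 1 by exact: density_le1.
(* [l] makes 2 / 4^l at most al / 16. [K] is the inverse of the sampling accuracy; its factor [l]
   pays for the [l] smoothing steps. *)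
pose l := (j + 3)%N; pose K : R := 2 ^+ 16 * l%:R.
have l1 : 1 <= l%:R :> R by rewrite ler1n /l addn3.
have K1 : 2 ^+ 16 <= K by rewrite ler_peMr ?exprn_ge0.
have K0 : 0 < K by apply: lt_le_trans K1; rewrite exprn_gt0.
have K2 : 1 <= K ^+ 2 by rewrite exprn_ege1 // (le_trans _ K1) // exprn_ege1 // ler1n.
have p1 : 1 <= p.+1%:R :> R by rewrite ler1n.
have [m [mlo mhi]] : exists m : nat, p.+1%:R * K ^+ 2 <= m%:R * al /\
    m%:R * al <= 2 * (p.+1%:R * K ^+ 2).
  by apply: sample_size => //; rewrite mulr_ege1.
have KK : K ^+ 2 * K^-1 ^+ 2 = 1 by rewrite -exprMn divff ?expr1n ?gt_eqF.
have d20 : 0 <= K^-1 ^+ 2 by rewrite exprn_ge0 ?invr_ge0 ?ltW.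
set F := \sum_x self_conv R A x ^+ p.+1.
have aF : 2 ^+ n * al ^+ p.+1 <= F by exact: density_pow_le.
have F0 : 0 < F by apply: lt_le_trans aF; rewrite mulr_gt0 ?exprn_gt0.
(* Twice the bound of [sample_conv_error] at d = 1/K, as [almost_periods] asks for B / 2. *)
pose B : R := 8 * (256 * K^-1) ^+ p.+1 * F.
have B0 : 0 < B by rewrite !mulr_gt0 ?exprn_gt0 ?mulr_gt0 ?invr_gt0.
have [T Tcard Tper] : exists2 T : {set 'rV['F_2]_n}, 2 ^+ n * al ^+ m <= 2 * #|T|%:R &
    forall s t, s \in T -> t \in T ->
      \sum_x `|self_conv R A (x + s + t) - self_conv R A x| ^+ p.+1 <= 2 ^+ p.+1 * B.
  apply: almost_periods => //.
  have -> : B / 2 = 4 * (256 * K^-1) ^+ p.+1 * F by rewrite /B; field.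
  apply: sample_conv_error => //; rewrite ?invr_gt0 //.
  - by rewrite lef_pV2 ?posrE //; apply: le_trans K1; rewrite -[leLHS]expr1 ler_weXn2l // ler1n.
  - by have := ler_wpM2r d20 mlo; rewrite -(mulrA p.+1%:R) KK mulr1.
  - by have := ler_wpM2r d20 mhi; rewrite -(mulrA 2) -(mulrA p.+1%:R) KK mulr1.
have [T' [V [T'T T'0 Vdim reg]]] := regular_subset_dim al0 alj Tcard.
(* The codimension is at most 2 (1 + j m), where m al <= 2 (p+1) K^2 and K^2 <= 2^36 j^2 because l
   <= 4j. *)
have pV : (p.+1 <= \dim V)%N.
  rewrite -(leq_add2r (2 * (1 + j * m))) (leq_trans _ Vdim) //.
  rewrite -(ler_nat R) -(ler_pM2l al0); apply: le_trans large.
  have jl : l%:R <= 4 * j%:R :> R.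
    by rewrite -natrM ler_nat /l mulSn leq_add2l leq_pmulr.
  have Kj : K ^+ 2 <= 2 ^+ 36 * j%:R ^+ 2.
    have -> : 2 ^+ 36 * j%:R ^+ 2 = (2 ^+ 16 * (4 * j%:R)) ^+ 2 :> R by ring.
    by rewrite lerXn2r ?nnegrE ?mulr_ge0 ?ler0n ?exprn_ge0 // ler_wpM2l ?exprn_ge0.
  have j1 : 1 <= j%:R :> R by rewrite ler1n.
  rewrite !natrD !natrM natrD natrM.
  have -> : (2 : R) ^+ 40 = 16 * 2 ^+ 36 by ring.
  have Q1 : 1 <= (2 : R) ^+ 36 by rewrite exprn_ege1 // ler1n.
  move: Kj Q1; set Q := (2 : R) ^+ 36; clearbody Q; move: (K ^+ 2) mhi => k mhi Kj Q1.
  set P : R := p.+1%:R in mhi p1 *; set J : R := j%:R in j1 Kj *.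
  have j3 : 1 <= J ^+ 3 by rewrite exprn_ege1.
  have h1 : J * (m%:R * al) <= 2 * P * Q * J ^+ 3.
    have -> : 2 * P * Q * J ^+ 3 = J * (2 * P * (Q * J ^+ 2)) by ring.
    rewrite ler_wpM2l ?(le_trans _ j1) //; apply: le_trans mhi _.
    by rewrite mulrA ler_wpM2l // mulr_ge0 // (le_trans _ p1).
  have h2 : P <= P * Q * J ^+ 3.
    by rewrite -mulrA ler_peMr ?mulr_ege1 // (le_trans _ p1).
  have h3 : al * (P + 2 * (1 + J * m%:R)) <= P + 2 + 2 * (J * (m%:R * al)).
    have -> : al * (P + 2 * (1 + J * m%:R)) = al * (P + 2) + 2 * (J * (m%:R * al)) by ring.
    by rewrite lerD2r ler_piMl // addr_ge0 // (le_trans _ p1).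
  apply: le_trans h3 _; have -> : 16 * Q * P * J ^+ 3 = 16 * (P * Q * J ^+ 3) by ring.
  have w2 : 2 * P * Q * J ^+ 3 = 2 * (P * Q * J ^+ 3) by ring.
  by rewrite w2 in h1; move: h1 h2; set w := P * Q * J ^+ 3; lra.
have [U UV Udim] := subspace_of_dim pV.
pose f := self_conv R A; pose g := iter l (smooth T') f.
have close : \sum_x `|g x - f x| ^+ p.+1 <= 16^-1 ^+ p.+1 * F.
  have Tper' s t : s \in T' -> t \in T' ->
      \sum_x `|f (x + s + t) - f x| ^+ p.+1 <= 2 ^+ p.+1 * B.
    by move=> /(fintype.subsetP T'T) sT /(fintype.subsetP T'T) tT; exact: Tper.
  apply: le_trans (iter_smooth_close l T'0 (smooth_close T'0 Tper')) _.
  (* Here l * 2 * 256 / K = 2^(-7) = 1/16 * 1/8; the spare 1/8 absorbs the factor 8 of [B]. *)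
  have -> : l%:R ^+ p.+1 * (2 ^+ p.+1 * B) = 8 * (16^-1 * 8^-1) ^+ p.+1 * F.
    have -> : 16^-1 * 8^-1 = l%:R * (2 * (256 * K^-1)) :> R.
      by rewrite /K; field; rewrite gt_eqF // (lt_le_trans ltr01).
    by rewrite /B; move: (256 * K^-1) => c; rewrite 2!exprMn; ring.
  rewrite ler_wpM2r ?(ltW F0) // exprMn mulrCA ler_piMr ?exprn_ge0 //.
  by rewrite exprVn ler_pdivrMr ?exprn_gt0 // mul1r exprS ler_peMr // exprn_ege1 // ler1n.
have small : 2 ^+ n * (2 / 4 ^+ l) ^+ p.+1 <= 16^-1 ^+ p.+1 * F.
  have e4 : 2 / 4 ^+ l <= 16^-1 * al.
    have -> : (4 : R) ^+ l = 64 * (2 ^+ j * 2 ^+ j).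
      by rewrite /l exprD -exprMn mulrC; congr (_ * _ ^+ _); ring.
    have t1 : 1 <= 2 ^+ j :> R by rewrite exprn_ege1 // ler1n.
    rewrite ler_pdivrMr ?mulr_gt0 ?exprn_gt0 //.
    have : 1 <= al * 2 ^+ j * 2 ^+ j by rewrite mulr_ege1.
    by lra.
  have h : (2 / 4 ^+ l) ^+ p.+1 <= (16^-1 * al) ^+ p.+1.
    by rewrite lerXn2r ?nnegrE ?mulr_ge0 ?divr_ge0 ?exprn_ge0 // ltW.
  have N0 : 0 <= (2 : R) ^+ n by rewrite exprn_ge0.
  apply: le_trans (ler_wpM2l N0 h) _.
  by rewrite exprMn mulrCA ler_wpM2l ?exprn_ge0.
have [x xU] : exists x, affine_subspace x U \subset sumset A A.
  (* The exponent p+1 is also the dimension of U, so the 2^(p+1) elements of U cost only a factor 2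
     in the base: (2 * 3 / 16)^(p+1) < 1. *)
  apply: (@affine_subspace_sumset R n A U p (3 ^+ p.+1 * 16^-1 ^+ p.+1)) => //.
    rewrite Udim -!exprMn exprn_ilt1 //; lra.
  move=> v vU; rewrite -mulrA; apply: translate_close close _ small.
  by move=> x; apply: iter_smooth_translate A0 T'0 reg _; exact: (subvP UV).
by exists x, U.
Qed.

(** * Extreme cases and the theorem *)

(** If x is not in A + A, then A and x + A are disjoint, so A fills at most half of the space. *)
Lemma sumset_full (R : realType) (n : nat) (A : {set 'rV['F_2]_n}) (x : 'rV['F_2]_n) :
  2^-1 < density R A -> x \in sumset A A.
Proof.
move=> big; apply: contraTT big => xA; rewrite -leNgt ler_pdivrMr ?exprn_gt0 //.
have dis : A :&: [set x + a | a in A] = finset.set0.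
  apply/finset.setP => y; rewrite !finset.inE; apply/negP => /andP[yA /imsetP[a aA ya]].
  case/negP: xA; apply/imset2P; exists y a => //.
  by rewrite ya addrK_F2.
have := max_card (mem (A :|: [set x + a | a in A])).
rewrite cardsU dis cards0 subn0 (card_imset _ (addrI x)) card_rV_F2 -(ler_nat R).
by rewrite natrD natrX; lra.
Qed.

Lemma affine_line_sumset (n : nat) (A : {set 'rV['F_2]_n}) (a b : 'rV['F_2]_n) :
  a \in A -> b \in A -> affine_subspace 0 <[a + b]> \subset sumset A A.
Proof.
move=> aA bA; apply/fintype.subsetP => _ /imsetP[v /vlineP[k ->] ->]; rewrite add0r.
have [->|k0] := eqVneq k 0.
  by rewrite scale0r; apply/imset2P; exists a a => //; rewrite addrr_F2.
have -> : k = 1 by apply/val_inj; case: k k0 => [[|[|]]].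
by rewrite scale1r; apply/imset2P; exists a b.
Qed.

(** For n > 0 a singleton has a sumset of dimension 0, below the positive bound, whence the
    condition on |A|. The first alternative covers density 1, where the logarithm vanishes. *)
Theorem theorem5p2 (R : realType) :
  exists2 c : R, 0 < c &
    forall (n : nat) (A : {set 'rV['F_2]_n}) (alpha : R),
      alpha = density R A -> 0 < alpha ->
      exists (x : 'rV['F_2]_n) (U : {vspace 'rV['F_2]_n}),
        affine_subspace x U \subset sumset A A /\
        ((1 < #|A|)%N ->
           \dim U = n \/
           alpha < 1 /\
           c * (alpha / log2 (1 / alpha) ^+ 3 * n%:R) <= (\dim U)%:R).
Proof.
(* 2^40 comes from [sumset_affine_subspace], 2^3 from j <= 2L cubed, and 2 from truncating the
   dimension. *)
exists (2 ^- 44) => [|n A al alE al0]; first by rewrite invr_gt0 exprn_gt0.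
have A0 : (0 < #|A|)%N.
  by rewrite lt0n; apply: contraTneq al0 => c0; rewrite alE /density c0 mul0r ltxx.
have [a aA] : exists a, a \in A by apply/card_gt0P.
have [A1|A1] := ltnP 1 #|A|; last first.
  (* As a + a = 0, this is the zero subspace. *)
  by exists 0, <[a + a]>%VS; split=> //; exact: affine_line_sumset.
have [big|small] := ltP 2^-1 al.
  exists 0, fullv; split.
    by apply/fintype.subsetP => x _; apply: (@sumset_full R); rewrite -alE.
  by left; rewrite dimvf /dim /= mul1n.
set L := log2 (1 / al).
have ln2 : 0 < ln (2 : R) by rewrite ln_gt0 // ltr1n.
have expL : expR (L * ln 2) = al^-1.
  by rewrite /L /log2 divfK ?gt_eqF // div1r lnK // posrE invr_gt0.
have exp2 k : expR (k%:R * ln 2) = 2 ^+ k :> R.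
  by rewrite expRM_natl lnK // posrE.
have L1 : 1 <= L.
  rewrite -(ler_pM2r ln2) -ler_expR expL (exp2 1%N) expr1.
  by rewrite -[leLHS]invrK lef_pV2 ?posrE.
have L3 : 0 < L ^+ 3 by rewrite exprn_gt0 // (lt_le_trans ltr01).
have -> : 2 ^- 44 * (al / L ^+ 3 * n%:R) = (al * n%:R / (2 ^+ 43 * L ^+ 3)) / 2.
  by rewrite (exprS _ 43) !invfM; ring.
set y := al * n%:R / (2 ^+ 43 * L ^+ 3).
have D0 : 0 < 2 ^+ 43 * L ^+ 3 by rewrite mulr_gt0 // exprn_gt0.
have y0 : 0 <= y by apply: divr_ge0 (ltW D0); apply: mulr_ge0 (ltW al0) (ler0n _ _).
have al1 : al < 1 by apply: le_lt_trans small _; lra.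
(* The required dimension is y / 2, so a line suffices when y < 1; otherwise the integer part of y
   is at least y / 2. *)
have [y1|y1] := ltP y 1.
  have [b bA ab] : exists2 b, b \in A & b != a.
    have /card_gt0P[b] : (0 < #|A :\ a|)%N by move: A1; rewrite (cardsD1 a) aA.
    by rewrite !finset.inE => /andP[ba bA]; exists b.
  exists 0, <[a + b]>%VS; split; first exact: affine_line_sumset.
  move=> _; right; split => //; rewrite dim_vline.
  have -> : a + b != 0.
    by apply: contraNneq ab => ab0; rewrite -[b](addrK_F2 _ a) [b + a]addrC ab0 add0r.
  by rewrite /=; lra.
have /andP[ylo yhi] := truncn_itv y0.
have p0 : (0 < Num.truncn y)%N by rewrite truncn_gt0.
case E : (Num.truncn y) p0 => [//|p] _; rewrite E in ylo yhi.
have L0 : 0 <= L by rewrite (le_trans ler01).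
have /andP[Llo Lhi] := truncn_itv L0.
(* An integer above L, so that 2^j >= 1/al; since L >= 1 it is at most 2L. *)
set j := (Num.truncn L).+1 in Lhi.
have jL : j%:R <= 2 * L by rewrite /j -addn1 natrD; lra.
have alj : 1 <= density R A * 2 ^+ j.
  rewrite -alE -ler_pdivrMl // mulr1 -expL -exp2 ler_expR ler_pM2r //.
  exact: ltW.
have [x [U [xU Udim]]] : exists (x : 'rV['F_2]_n) (U : {vspace 'rV['F_2]_n}),
    affine_subspace x U \subset sumset A A /\ \dim U = p.+1.
  apply: (@sumset_affine_subspace R n A j p) => //; rewrite -alE.
  move: ylo; rewrite /y ler_pdivlMr //; apply: le_trans.
  have j3 : j%:R ^+ 3 <= (2 * L) ^+ 3 by rewrite lerXn2r ?nnegrE ?ler0n // mulr_ge0.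
  have -> : p.+1%:R * (2 ^+ 43 * L ^+ 3) = 2 ^+ 40 * p.+1%:R * (2 * L) ^+ 3 by ring.
  by rewrite ler_wpM2l // mulr_ge0 ?exprn_ge0 ?ler0n.
exists x, U; split => // _; right; split => //; rewrite Udim.
rewrite ler_pdivrMr //; apply: le_trans (ltW yhi) _.
by rewrite -natrM ler_nat muln2 -addnn addSn ltnS leq_addl.
Qed.
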